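(* Fix $\alpha\in(0,1)$ and consider the two-stage procedure described in the context, with first-stage sample size $N_0=N_0(d)$, final sample size $\widehat N_{opt}=\widehat N_{opt}(d)$, and asymptotically optimal sample size $N_{opt}^*=N_{opt}^*(d)=\sigma_\mu^2\Phi^{-1}(1-\alpha/2)^2/d^2$. Suppose that the variance estimator is consistent and asymptotically unbiased, i.e. $\widehat\sigma_{N_0}^2/\sigma_\mu^2 = 1+o_P(1)$ and $E(\widehat\sigma_{N_0}^2)/\sigma_\mu^2 = 1+o(1)$ as $d\downarrow 0$. Then: (i) $\widehat N_{opt}$ is consistent for $N_{opt}^*$: $\ \widehat N_{opt}/N_{opt}^* = 1+o_P(1)$ as $d\downarrow 0$. (ii) $\widehat N_{opt}$ is asymptotically first order efficient for $N_{opt}^*$: $\ E(\widehat N_{opt})/N_{opt}^* = 1+o(1)$ as $d\downarrow 0$. If, in addition, $\widehat\mu_n$ satisfies the random central limit theorem, i.e. for every family $\{N_a: a>0\}$ of stopping times with $N_a/a\to k$ in probability as $a\to\infty$ for some $0<k<\infty$ it holds that $\sqrt{N_a}(\widehat\mu_{N_a}-\mu)/\sigma_\mu \to N(0,1)$ in distribution as $a\to\infty$, then: (iii) The fixed-width confidence interval $I_{\widehat N_{opt}}=[\widehat\mu_{\widehat N_{opt}}-d,\ \widehat\mu_{\widehat N_{opt}}+d]$ has asymptotic coverage $1-\alpha$: $\ P(I_{\widehat N_{opt}}\ni\mu) = 1-\alpha+o(1)$ as $d\downarrow 0$.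
   Context: $Y_1,Y_2,\dots$ are i.i.d. real random variables with mean $\mu$ and variance $\sigma^2\in(0,\infty)$. For each $n$, $\widehat\mu_n$ is an estimator of $\mu$ based on $Y_1,\dots,Y_n$ satisfying $\sqrt n(\widehat\mu_n-\mu)\to N(0,\sigma_\mu^2)$ in distribution for some constant $\sigma_\mu^2>0$, and $\widehat\sigma_n^2$ is an estimator of $\sigma_\mu^2$ based on $Y_1,\dots,Y_n$. $\Phi$ is the standard normal distribution function. $\widehat\sigma_{\mu,3}>0$ is a pilot estimate of $\sigma_\mu$ computed from three additional observations, on which one conditions throughout, so it is treated as a fixed positive constant. $\overline N_0\in\mathbb N$ is a given minimal sample size. For precision $d>0$ and confidence level $1-\alpha$, the first-stage sample size is $$N_0=\max\Big\{\overline N_0,\ \Big\lfloor \frac{\Phi^{-1}(1-\alpha/2)\,\widehat\sigma_{\mu,3}}{d}\Big\rfloor+1\Big\}$$ and the final sample size is $$\widehat N_{opt}=\max\Big\{N_0,\ \Big\lfloor \frac{\widehat\sigma_{N_0}^2\,\Phi^{-1}(1-\alpha/2)^2}{d^2}\Big\rfloor+1\Big\}.$$ *)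

(* Defs.v *)
From HB Require Import structures.
From mathcomp Require Import all_boot all_order all_algebra finmap.
From mathcomp Require Import archimedean.
From mathcomp Require Import all_classical all_reals all_analysis.

Set Implicit Arguments.
Unset Strict Implicit.
Unset Printing Implicit Defensive.

Import Order.TTheory GRing.Theory Num.Theory.
Import numFieldNormedType.Exports.

Local Open Scope classical_set_scope.
Local Open Scope ring_scope.

Section normal_quantile.
Context {R : realType}.

Definition Phi (x : R) : R := fine (normal_prob (0 : R) 1 `]-oo, x]).

Definition Phi_inv : R -> R := pinv [set: R] Phi.

End normal_quantile.

Section modes_of_convergence.
Context (d : measure_display) (T : measurableType d) (R : realType).
Variable P : probability T R.

Definition cvg_in_probability (I : Type) (F : set_system I)
    (X : I -> T -> R) (l : R) : Prop :=
  forall e : R, 0 < e ->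
    P [set w | e < `|X i w - l|] @[i --> F] --> (0 : \bar R).

(* Convergence of the distribution functions at every continuity point of the
   limiting one. *)
Definition cvg_in_distribution (I : Type) (F : set_system I)
    (X : I -> T -> R) (nu : set R -> \bar R) : Prop :=
  forall x : R, {for x, continuous (fun y : R => nu `]-oo, y]%classic)} ->
    P [set w | X i w <= x] @[i --> F] --> nu `]-oo, x]%classic.

End modes_of_convergence.

Section sampling.
Context (d : measure_display) (T : measurableType d) (R : realType).
Variables (P : probability T R) (Y : nat -> {RV P >-> R}).

Definition mutually_independent : Prop :=
  forall (J : {fset nat}) (A : nat -> set R),
    (forall i, measurable (A i)) ->
    P (\bigcap_(i in [set` J]) (Y i @^-1` A i)) =
    (\prod_(i <- J) P (Y i @^-1` A i))%E.

(* The laws are compared on measurable sets only: a measure is a total function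
   on sets, with arbitrary values outside the sigma-algebra. *)
Definition identically_distributed : Prop :=
  forall (i : nat) (A : set R), measurable A ->
    distribution P (Y i) A = distribution P (Y 0%N) A.

(* Indices are shifted: Y 0, ..., Y n.-1 are the observations Y_1, ..., Y_n.
   An estimator based on them is a measurable function of this tuple. *)
Definition sample (n : nat) (w : T) : n.-tuple R := [tuple Y i w | i < n].

(* tau is a stopping time of the filtration generated by the observations:
   {tau <= n} belongs to the sigma-algebra generated by Y 0, ..., Y n.-1. *)
Definition stopping_time (tau : T -> nat) : Prop :=
  forall n : nat,
    g_sigma_preimage (fun i : 'I_n => (Y i : T -> R)) [set w | (tau w <= n)%N].

Definition random_clt (muhat : forall n : nat, {mfun n.-tuple R >-> R})
    (mu sigma_mu : R) : Prop :=
  forall (N : R -> T -> nat) (k : R),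
    (forall a : R, 0 < a -> stopping_time (N a)) ->
    0 < k ->
    cvg_in_probability P +oo (fun a w => (N a w)%:R / a) k ->
    cvg_in_distribution P +oo
      (fun a w => Num.sqrt (N a w)%:R
                  * (muhat (N a w) (sample (N a w) w) - mu) / sigma_mu)
      (normal_prob (0 : R) 1).

End sampling.

Section two_stage_procedure.
Context {R : realType}.

(* For 0 < alpha < 1 the arguments of Num.truncn below are nonnegative, so
   Num.truncn is the floor function there. *)

Definition first_stage_size (N0bar : nat) (alpha sigma3 d : R) : nat :=
  maxn N0bar (Num.truncn (Phi_inv (1 - alpha / 2) * sigma3 / d)).+1.

(* s2 is the value of the first-stage variance estimate. *)
Definition final_size (N0 : nat) (s2 alpha d : R) : nat :=
  maxn N0 (Num.truncn (s2 * Phi_inv (1 - alpha / 2) ^+ 2 / d ^+ 2)).+1.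

Definition optimal_size (sigma_mu alpha d : R) : R :=
  sigma_mu ^+ 2 * Phi_inv (1 - alpha / 2) ^+ 2 / d ^+ 2.

End two_stage_procedure.

(* Main.v *)
Require Import Defs.
From HB Require Import structures.
From mathcomp Require Import all_boot all_order all_algebra finmap.
From mathcomp Require Import archimedean.
From mathcomp Require Import all_classical all_reals all_analysis.
From mathcomp Require Import measurable_realfun.
From mathcomp Require Import lra ring.

Set Implicit Arguments.
Unset Strict Implicit.
Unset Printing Implicit Defensive.

Import Order.TTheory GRing.Theory Num.Theory.
Import numFieldNormedType.Exports.

Local Open Scope classical_set_scope.
Local Open Scope ring_scope.

(* Write z for the normal quantile. By truncation N_opt exceeds s^2 z^2 / d^2,
   s^2 being the first-stage variance estimate, by at most N_0 + 1 = O(1/d),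
   which is negligible with respect to N_opt^* = sigma_mu^2 z^2 / d^2; so
   N_opt / N_opt^* and s^2 / sigma_mu^2 differ by a deterministic o(1), which
   gives (i) and (ii). For (iii), N_opt is a stopping time because {N_opt <= n}
   is empty for n < N_0 and depends on the first N_0 observations otherwise;
   with a = 1/d^2, (i) says N_opt / a --> (sigma_mu z)^2 in probability, so the
   random central limit theorem applies to the studentized error Z. The
   interval covers mu iff |Z| <= sqrt N_opt d / sigma_mu, whose right-hand side
   tends to z in probability. *)

(** * The standard normal distribution function and its quantiles *)

Section standard_normal.
Context {R : realType}.
Implicit Types p x y : R.
Local Notation nu := (normal_prob (0 : R) 1).
Local Notation leb := lebesgue_measure.

Let nu_fin_num (A : set R) : measurable A -> nu A \is a fin_num.
Proof. by move=> mA; exact: fin_num_measure. Qed.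

Lemma normal_prob_ray x : nu `]-oo, x] = (Phi x)%:E.
Proof. by rewrite /Phi fineK// nu_fin_num. Qed.

Lemma nondecreasing_Phi : {homo @Phi R : x y / x <= y}.
Proof.
move=> x y xy; rewrite -lee_fin -!normal_prob_ray.
by apply: le_measure; rewrite ?inE//; apply: subset_itvl; rewrite bnd_simp.
Qed.

(** The density never exceeds its peak. The explicit constant later converts a shift of the argument
    into an error in probability. *)
Lemma Phi_lipschitz x y : x <= y -> Phi y - Phi x <= normal_peak 1 * (y - x).
Proof.
move=> xy; rewrite lerBlDl -lee_fin EFinD -!normal_prob_ray.
have -> : `]-oo, y]%classic = `]-oo, x] `|` `]x, y] :> set R.
  by rewrite -itv_bndbnd_setU// bnd_simp.
apply: le_trans (measureU2 _ _ _) _ => //.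
rewrite leeD2l// /normal_prob.
apply: (@le_trans _ _ (\int[leb]_(z in `]x, y]) (normal_peak 1)%:E)%E).
  apply: ge0_le_integral => //=.
  - by move=> z _; rewrite lee_fin normal_pdf_ge0.
  - by apply/measurable_EFinP/measurable_funTS; exact: measurable_normal_pdf.
  - by move=> z _; rewrite lee_fin normal_pdf_ub ?oner_eq0.
rewrite integral_cst//= lebesgue_measure_itv/= lte_fin.
move: xy; rewrite le_eqVlt => /orP[/eqP ->|->]; last by rewrite EFinM.
by rewrite ltxx subrr mulr0 mule0.
Qed.

Lemma continuous_Phi : continuous (@Phi R).
Proof.
have c0 : 0 < normal_peak (1 : R) by rewrite normal_peak_gt0 ?oner_eq0.
move=> x; apply/cvgrPdist_le => e e0; near=> y.
have {}xy : normal_peak 1 * `|x - y| <= e.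
  rewrite mulrC -ler_pdivlMr//; near: y.
  by exists (e / normal_peak 1) => [|z /= /ltW//]; exact: divr_gt0.
have [yx|/ltW yx] := leP y x.
  rewrite ger0_norm ?subr_ge0 ?nondecreasing_Phi//.
  by rewrite (le_trans (Phi_lipschitz yx))// -[x - y]ger0_norm ?subr_ge0.
rewrite distrC ger0_norm ?subr_ge0 ?nondecreasing_Phi//.
by rewrite (le_trans (Phi_lipschitz yx))// -[y - x]ger0_norm ?subr_ge0// distrC.
Unshelve. all: by end_near. Qed.

(** The density is even, which exchanges the two tails; open and closed rays have the same mass
    because a law with a density has no atoms. *)
Lemma PhiN x : Phi (- x) = 1 - Phi x.
Proof.
apply/EFin_inj; rewrite -normal_prob_ray EFinB -normal_prob_ray.
have -> : nu `]-oo, - x] = nu `[x, +oo[.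
  rewrite /normal_prob ge0_integration_by_substitutionNy; first last.
  - by move=> y _; rewrite normal_pdf_ge0.
  - by apply: continuous_subspaceT;
    apply: continuous_normal_pdf; rewrite oner_eq0.
  apply: eq_integral => y _; rewrite !normal_pdfE ?oner_eq0//=.
  by rewrite /normal_fun !subr0 sqrrN.
have -> : `[x, +oo[%classic = ~` `]-oo, x[%classic :> set R.
  by rewrite setCitvl.
rewrite probability_setC//; congr (_ - _)%E.
have nux : nu [set x] = 0%E.
  have := @normal_prob_dominates R 0 1 => /null_content_dominatesP; apply => //.
  exact: lebesgue_measure_set1.
have -> : `]-oo, x]%classic = `]-oo, x[ `|` [set x] :> set R.
  by rewrite setUitv1.
rewrite measureU//; first by rewrite [X in (_ + X)%E](_ : _ = 0%E) ?adde0.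
by apply/seteqP; split => //= y [] /=; rewrite in_itv/= => + yx; rewrite yx ltxx.
Qed.

(** Under [nu] the identity is a random variable whose cdf is [Phi]; the general limits of a cdf at
    both infinities then apply to [Phi]. *)
Let idT : measurableTypeR R -> R := idfun.

#[local] HB.instance Definition _ :=
  @isMeasurableFun.Build _ _ _ _ idT (@measurable_id _ _ setT).

Let cdf_Phi : cdf (idT : {RV nu >-> R}) = EFin \o Phi.
Proof.
apply/funext => x; rewrite /cdf /distribution /pushforward preimage_id/=.
exact: normal_prob_ray.
Qed.

(** [Phi] is continuous with limits 0 and 1, so by the intermediate value theorem [p] lies in its
    range, where the partial inverse is a right inverse. *)
Lemma Phi_invK p : 0 < p < 1 -> Phi (Phi_inv p) = p.
Proof.
move=> /andP[p0 p1]; rewrite /Phi_inv pinvK// inE.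
have Phi_y : Phi x @[x --> +oo] --> (1 : R).
  by have /fine_cvg := @cvg_cdfy1 _ _ _ _ (idT : {RV nu >-> R});
    rewrite cdf_Phi.
have Phi_Ny : Phi x @[x --> -oo] --> (0 : R).
  by have /fine_cvg := @cvg_cdfNy0 _ _ _ _ (idT : {RV nu >-> R});
    rewrite cdf_Phi.
near (pinfty_nbhs R) => b; near (ninfty_nbhs R) => a.
have ab : a <= b.
  by apply: (@le_trans _ _ 0);
    [near: a; exact: nbhs_ninfty_le|near: b; exact: nbhs_pinfty_ge].
have pa : Phi a <= p by apply/ltW; near: a; exact: (cvgr_lt _ Phi_Ny).
have pb : p <= Phi b by apply/ltW; near: b; exact: (cvgr_gt _ Phi_y).
have [||c _ <-] := @IVT _ (@Phi R) a b p ab; last by exists c.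
- exact/continuous_subspaceT/continuous_Phi.
- by rewrite ge_min pa/= le_max pb orbT.
Unshelve. all: by end_near. Qed.

(** By symmetry [Phi 0] is 1/2, so monotonicity rules out a nonpositive quantile. *)
Lemma Phi_inv_gt0 p : 2^-1 < p < 1 -> 0 < Phi_inv p.
Proof.
move=> /andP[p2 p1]; rewrite ltNge; apply/negP => /nondecreasing_Phi.
have -> : Phi (0 : R) = 2^-1 by have := PhiN 0; rewrite oppr0; lra.
rewrite Phi_invK; first by rewrite leNgt p2.
by rewrite p1 andbT (lt_trans _ p2)// invr_gt0.
Qed.

End standard_normal.

(** * Stopping times and stopped sequences *)

Section stopping_times.
Context d (T : measurableType d) (R : realType) (P : probability T R).
Variable Y : nat -> {RV P >-> R}.

(** The coordinates of the sample of size [m] are among the first [n] observations, so passing from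
    [m] to [n] only adds generators. *)
Lemma g_sigma_preimage_sample (m n : nat) (B : set (m.-tuple R)) :
  (m <= n)%N -> measurable B ->
  g_sigma_preimage (fun i : 'I_n => (Y i : T -> R)) (sample Y m @^-1` B).
Proof.
move=> mn mB.
have : g_sigma_preimage (fun i : 'I_m => (Y i : T -> R)) (sample Y m @^-1` B).
  have -> : (fun i : 'I_m => (Y i : T -> R)) =
            (fun i => @tnth m R ^~ i \o sample Y m).
    by apply/funext => i; apply/funext => w; rewrite /= tnth_mktuple.
  by rewrite g_sigma_preimage_comp; exists B => //; rewrite setTI.
apply: smallest_sub => [|A]; first exact: smallest_sigma_algebra.
rewrite -bigcup_seq => -[i _ mA]; apply: sub_sigma_algebra; rewrite -bigcup_seq.
by exists (widen_ord mn i) => //=; rewrite mem_index_enum.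
Qed.

Lemma measurable_sample n : measurable_fun setT (sample Y n).
Proof.
apply/measurable_fun_tnthP => i.
by apply: (eq_measurable_fun (Y i)) => // w _; rewrite /= tnth_mktuple.
Qed.

Lemma stopping_time_measurable (tau : T -> nat) :
  stopping_time Y tau -> forall n, measurable [set w | (tau w <= n)%N].
Proof.
move=> stau n; move: (stau n); apply: smallest_sub.
  exact: sigma_algebra_measurable.
rewrite -bigcup_seq => A [i _ [B mB <-]].
exact: measurable_funPT.
Qed.

(** [tau] takes countably many values, and where it equals [n] the map is [f n]. *)
Lemma measurable_stopped d' (U : measurableType d') (tau : T -> nat)
    (f : nat -> T -> U) :
  stopping_time Y tau -> (forall n, measurable_fun setT (f n)) ->
  measurable_fun setT (fun w => f (tau w) w).
Proof.
move=> /stopping_time_measurable mtau mf _ B mB; rewrite setTI.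
have -> : (fun w => f (tau w) w) @^-1` B =
    \bigcup_n ([set w | tau w = n] `&` f n @^-1` B).
  apply/seteqP; split => [w Bw|w [n _ [/= <-]]//].
  by exists (tau w).
apply: bigcup_measurable => n _; apply: measurableI; last first.
  by rewrite -[X in measurable X]setTI; exact: mf.
(* The filtration provides the events [tau <= n]; a level set is a difference of two consecutive
   ones, except at 0. *)
case: n => [|n].
  rewrite (_ : mkset _ = [set w | (tau w <= 0)%N])//.
  by apply/seteqP; split => w /=; rewrite leqn0 => /eqP.
rewrite (_ : mkset _ = [set w | (tau w <= n.+1)%N] `\` [set w | (tau w <= n)%N]).
  exact: measurableD.
apply/seteqP; split => w /= => [->|[tw /negP]].
  by split => //; rewrite ltnn.
by rewrite -ltnNge => nt; apply/eqP; rewrite eqn_leq tw.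
Qed.

End stopping_times.

(** * Transfer of convergence in probability, and a Slutsky-type limit *)

Section convergence_in_probability.
Context d (T : measurableType d) (R : realType) (P : probability T R).

Lemma measurable_dist_gt (X : T -> R) (l e : R) :
  measurable_fun setT X -> measurable [set w | e < `|X w - l|].
Proof.
move=> mX; rewrite -[X in measurable X]setTI.
rewrite (_ : mkset _ = (fun w => `|X w - l|) @^-1` `]e, +oo[); last first.
  by apply/seteqP; split => w /=; rewrite in_itv/= andbT.
by apply: measurableT_comp => //; exact: measurable_funB.
Qed.

(** Once [c i] is below [e / 2], a deviation of [X'] beyond [e] forces one of [X] beyond
    [e / 2 / C]. *)
Lemma cvg_in_probability_dominated (I : Type) (F : set_system I)
    {FF : Filter F} (C l l' : R)
    (c : I -> R) (X X' : I -> T -> R) :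
  0 < C ->
  c @ F --> 0 ->
  (\forall i \near F, measurable_fun setT (X i)) ->
  (\forall i \near F, measurable_fun setT (X' i)) ->
  (\forall i \near F, forall w, `|X' i w - l'| <= C * `|X i w - l| + c i) ->
  cvg_in_probability P F X l -> cvg_in_probability P F X' l'.
Proof.
move=> C0 c0 mX mX' XX' cX e e0.
have e2C : 0 < e / 2 / C by rewrite !divr_gt0.
apply: (@squeeze_cvge _ _ _ _ (cst 0%E) _ _ _ _ (cvg_cst _) (cX _ e2C)).
near=> i; rewrite measure_ge0/=; apply: le_measure; rewrite ?inE.
- by apply: measurable_dist_gt; near: i.
- by apply: measurable_dist_gt; near: i.
move=> w /=; have ci : `|c i| < e / 2.
  by near: i; apply: cvgr0_norm_lt => //; exact: divr_gt0.
have Xi : `|X' i w - l'| <= C * `|X i w - l| + c i by move: w; near: i.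
rewrite ltr_pdivrMr// => eX; rewrite mulrC.
by move: ci; rewrite ltr_norml => /andP[_ ci]; lra.
Unshelve. all: by end_near. Qed.

(* Slutsky: off an event of vanishing probability, B_i lies within e of z, so
   that |Z_i| <= B_i is squeezed between |Z_i| <= z - e and |Z_i| <= z + e. *)
Lemma cvg_random_interval (I : Type) (F : set_system I) {FF : Filter F}
    (Z B : I -> T -> R) (z : R) :
  0 <= z ->
  (\forall i \near F, measurable_fun setT (Z i)) ->
  (\forall i \near F, measurable_fun setT (B i)) ->
  cvg_in_distribution P F Z (normal_prob 0 1) ->
  cvg_in_probability P F B z ->
  P [set w | `|Z i w| <= B i w] @[i --> F] --> (Phi z - Phi (- z))%:E.
Proof.
move=> z0 mZ mB cZ cB.
have mle (f g : T -> R) : measurable_fun setT f -> measurable_fun setT g ->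
    measurable [set w | f w <= g w].
  by move=> mf mg; rewrite -[X in measurable X]setTI; exact: measurable_fun_le.
(* The limiting distribution function is continuous, so convergence holds at every point. *)
have cvgZ x : fine (P [set w | Z i w <= x]) @[i --> F] --> Phi x.
  have /fine_cvgP[] // : P [set w | Z i w <= x] @[i --> F] --> (Phi x)%:E.
  rewrite -normal_prob_ray; apply: cZ.
  rewrite (_ : (fun y => _) = EFin \o Phi); last first.
    by apply/funext => y; exact: normal_prob_ray.
  by apply: cvg_EFin; [exact: nearW|exact: continuous_Phi].
apply/fine_cvgP; split.
  near=> i; apply: fin_num_measure; apply: mle; last by near: i.
  by apply: measurableT_comp => //; near: i.
apply/cvgrPdist_le => eps eps0.
(* Error budget of the upper bound: one [h] for each of two distribution functions of [Z i], one for
   [D], and one plus two for shifting [Phi] by [e] and [2e]. The lower bound costs five [h]. *)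
pose h : R := eps / 6; have h0 : 0 < h by exact: divr_gt0.
pose c := normal_peak (1 : R).
have c0 : 0 < c by rewrite normal_peak_gt0 ?oner_eq0.
pose e := h / c; have e0 : 0 < e by exact: divr_gt0.
have Z_le x : \forall i \near F, `|Phi x - fine (P [set w | Z i w <= x])| <= h.
  by have /cvgrPdist_le/(_ _ h0) := cvgZ x.
have /fine_cvgP[_ cD] : P [set w | e < `|B i w - z|] @[i --> F] --> 0%:E.
  exact: cB.
near=> i.
have mZi : measurable_fun setT (Z i) by near: i.
have mBi : measurable_fun setT (B i) by near: i.
have mZx x : measurable [set w | Z i w <= x] by exact: mle.
rewrite /=; set S := [set w | `|Z i w| <= _].
pose D := [set w | e < `|B i w - z|].
have mS : measurable S by apply: mle => //; exact: measurableT_comp.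
have mD : measurable D by exact: measurable_dist_gt.
have finP A : measurable A -> (fine (P A))%:E = P A.
  by move=> mA; rewrite fineK// fin_num_measure.
have D_le : `|0 - fine (P D)| <= h.
  by rewrite /D; near: i; move/cvgrPdist_le : cD => /(_ _ h0).
have Z1 : `|Phi (z + e) - fine (P [set w | Z i w <= z + e])| <= h.
  by near: i; exact: Z_le.
have Z2 : `|Phi (- z - e *+ 2) - fine (P [set w | Z i w <= - z - e *+ 2])| <= h.
  by near: i; exact: Z_le.
have Z3 : `|Phi (z - e) - fine (P [set w | Z i w <= z - e])| <= h.
  by near: i; exact: Z_le.
have Z4 : `|Phi (- z + e) - fine (P [set w | Z i w <= - z + e])| <= h.
  by near: i; exact: Z_le.
(* Off [D], the event [S] gives only [Z i >= - z - e], with equality possible; the second [e] makes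
   [L] disjoint from it. *)
pose L := [set w | Z i w <= - z - e *+ 2].
have upper : fine (P S) + fine (P [set w | Z i w <= - z - e *+ 2]) <=
    fine (P [set w | Z i w <= z + e]) + fine (P D).
  rewrite -lee_fin !EFinD !finP//.
  apply: (@le_trans _ _ (P (S `\` D) + P D + P L))%E.
    rewrite leeD2r//; apply: (@le_trans _ _ (P (S `\` D `|` D))).
      apply: le_measure; rewrite ?inE//.
        by apply: measurableU => //; exact: measurableD.
      by move=> w Sw; have [Dw|Dw] := pselect (D w); [right|left].
    by apply: measureU2 => //; exact: measurableD.
  rewrite addeAC leeD2r// -measureU; last 3 first.
  - exact: measurableD.
  - exact: mZx.
  - apply/seteqP; split => // w [[Sw /negP]]; rewrite /= -leNgt ler_norml.
    move: Sw; rewrite /S /L/= ler_norml => /andP[? ?] /andP[? ?] ?.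
    by exfalso; lra.
  apply: le_measure; rewrite ?inE//.
    by apply: measurableU; [exact: measurableD|exact: mZx].
  move=> w [[Sw /negP]|]; last by rewrite /L/= => ?; lra.
  rewrite /= -leNgt ler_norml.
  by move: Sw; rewrite /S/= ler_norml => /andP[? ?] /andP[? ?]; lra.
have lower : fine (P [set w | Z i w <= z - e]) <=
    fine (P S) + fine (P [set w | Z i w <= - z + e]) + fine (P D).
  rewrite -lee_fin !EFinD !finP//.
  apply: (@le_trans _ _ (P (S `|` [set w | Z i w <= - z + e] `|` D))).
    apply: le_measure; rewrite ?inE//; first by do 2 apply: measurableU => //.
    move=> w /= Zw.
    have [Dw|] := ltP e `|B i w - z|; first by right.
    rewrite ler_norml => /andP[B1 B2]; left.
    have [|Zw'] := leP (Z i w) (- z + e); first by right.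
    by left; rewrite /S/= ler_norml; apply/andP; split; lra.
  apply: le_trans (measureU2 _ _ _) _ => //; first exact: measurableU.
  by rewrite leeD2r//; exact: measureU2.
have lip x y : x <= y -> Phi y - Phi x <= c * (y - x) by exact: Phi_lipschitz.
have ce : c * e = h by rewrite /e mulrC divfK// gt_eqF.
have L1 : Phi (z + e) - Phi z <= h.
  by rewrite -ce (le_trans (lip _ _ _)) ?lerDl ?(ltW e0)// addrC addKr.
have L2 : Phi (- z) - Phi (- z - e *+ 2) <= h *+ 2.
  rewrite -ce (le_trans (lip _ _ _)) ?gerDl ?oppr_le0 ?mulrn_wge0 ?(ltW e0)//.
  by rewrite opprB addrC subrK mulrnAr.
have L3 : Phi z - Phi (z - e) <= h.
  by rewrite -ce (le_trans (lip _ _ _)) ?gerDl ?oppr_le0 ?(ltW e0)//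
    opprB addrC subrK.
have L4 : Phi (- z + e) - Phi (- z) <= h.
  by rewrite -ce (le_trans (lip _ _ _)) ?lerDl ?(ltW e0)// addrC addKr.
have eps6 : eps = h *+ 6 by rewrite /h; lra.
move: D_le Z1 Z2 Z3 Z4 upper lower.
rewrite !ler_norml => /andP[? ?] /andP[? ?] /andP[? ?] /andP[? ?] /andP[? ?] ? ?.
by apply/andP; split; lra.
Unshelve. all: by end_near. Qed.

End convergence_in_probability.

(** * Deterministic bounds on the sample sizes *)

Section two_stage_procedure.
Context {R : realType}.
Implicit Types alpha d : R.
Local Notation z alpha := (Phi_inv (1 - alpha / 2)).

(** The successor of the truncation exceeds its argument by at most 1, and a maximum of naturals is
    at most their sum. *)
Lemma final_size_bounds (N0 : nat) (s2 : R) alpha d : 0 <= s2 ->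
  s2 * z alpha ^+ 2 / d ^+ 2 <= (final_size N0 s2 alpha d)%:R
    <= N0%:R + 1 + s2 * z alpha ^+ 2 / d ^+ 2.
Proof.
move=> s20; rewrite /final_size; set x := _ / _.
have x0 : 0 <= x by rewrite /x divr_ge0 ?sqr_ge0// mulr_ge0 ?sqr_ge0.
apply/andP; split.
  by rewrite (le_trans (ltW (truncnS_gt x)))// ler_nat leq_maxr.
have /andP[tx _] := truncn_itv x0.
apply: (@le_trans _ _ (N0 + (Num.truncn x).+1)%:R).
  rewrite ler_nat geq_max leq_addr. by rewrite leq_addl.
by rewrite natrD -natr1; lra.
Qed.

(** Truncation lies below a natural number exactly when its argument does; this exposes the event as
    a measurable condition on [s2], for the stopping time property. *)
Lemma final_size_leq (N0 : nat) (s2 : R) alpha d n : 0 <= s2 ->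
  (final_size N0 s2 alpha d <= n)%N =
  (N0 <= n)%N && (s2 * z alpha ^+ 2 / d ^+ 2 < n%:R).
Proof.
move=> s20; rewrite geq_max truncn_lt_nat//.
by rewrite divr_ge0 ?sqr_ge0// mulr_ge0 ?sqr_ge0.
Qed.

(** In the quotient the quantile and [d] cancel from the main term, leaving the relative variance
    estimate and a deterministic remainder. *)
Lemma final_size_ratio (N0 : nat) (s2 sigma_mu : R) alpha d :
  0 <= s2 -> 0 < sigma_mu -> 0 < z alpha -> 0 < d ->
  s2 / sigma_mu ^+ 2 <=
    (final_size N0 s2 alpha d)%:R / optimal_size sigma_mu alpha d <=
    s2 / sigma_mu ^+ 2 + (N0%:R + 1) / optimal_size sigma_mu alpha d.
Proof.
move=> s20 sm0 z0 d0.
have Ns0 : 0 < optimal_size sigma_mu alpha d.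
  by rewrite /optimal_size !(divr_gt0, mulr_gt0, exprn_gt0).
have -> : s2 / sigma_mu ^+ 2 =
    s2 * z alpha ^+ 2 / d ^+ 2 / optimal_size sigma_mu alpha d.
  by rewrite /optimal_size; field; rewrite !gt_eqF.
rewrite -mulrDl !ler_pM2r ?invr_gt0// [in X in _ && X]addrC.
exact: final_size_bounds.
Qed.

(* N_0 is of order 1/d whereas N_opt^* is of order 1/d^2. *)
Lemma first_stage_size_negligible (N0bar : nat) alpha (sigma3 sigma_mu : R) :
  0 < sigma_mu -> 0 < sigma3 -> 0 < z alpha ->
  ((first_stage_size N0bar alpha sigma3 d)%:R + 1) /
    optimal_size sigma_mu alpha d @[d --> 0^'+] --> (0 : R).
Proof.
move=> sm0 s30 z0; pose k := sigma_mu ^+ 2 * z alpha ^+ 2.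
have k0 : 0 < k by rewrite mulr_gt0 ?exprn_gt0.
(* This is the bound [N0bar + 2 + z sigma3 / d] on the numerator, divided by the optimal size
   [k / d^2]; it is a polynomial in [d] vanishing at 0. *)
pose ub d := ((N0bar%:R + 2) * d * d + z alpha * sigma3 * d) / k.
have ub0 : ub d @[d --> 0^'+] --> (0 : R).
  have : ub d @[d --> 0^'+] --> ub 0.
    apply: cvg_at_right_filter.
    apply: cvgM; last exact: cvg_cst.
    apply: cvgD; first apply: cvgM => //; try apply: cvgM => //; exact: cvg_cst.
  by rewrite /ub !mulr0 addr0 mul0r.
apply: squeeze_cvgr (cvg_cst _) ub0; near=> d.
have d0 : 0 < d by [].
have Ns0 : 0 < optimal_size sigma_mu alpha d.
  by rewrite /optimal_size -/k divr_gt0 ?exprn_gt0.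
rewrite divr_ge0 ?(ltW Ns0) ?addr_ge0//= ler_pdivrMr//.
have -> : ub d * optimal_size sigma_mu alpha d =
    N0bar%:R + 2 + z alpha * sigma3 / d.
  by rewrite /ub /optimal_size -/k; field; rewrite !gt_eqF.
rewrite /first_stage_size; set x := _ / d.
have x0 : 0 <= x by rewrite /x divr_ge0 ?mulr_ge0// ltW.
have /andP[tx _] := truncn_itv x0.
have : (maxn N0bar (Num.truncn x).+1)%:R <= (N0bar + (Num.truncn x).+1)%:R :> R.
  rewrite ler_nat geq_max leq_addr. by rewrite leq_addl.
by rewrite natrD -natr1; lra.
Unshelve. all: by end_near. Qed.

End two_stage_procedure.

Lemma final_size_stopping_time d (T : measurableType d) (R : realType)
    (P : probability T R) (Y : nat -> {RV P >-> R}) (N0 : nat)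
    (s2 : N0.-tuple R -> R) (alpha delta : R) :
  measurable_fun setT s2 -> (forall t, 0 <= s2 t) ->
  stopping_time Y (fun w => final_size N0 (s2 (sample Y N0 w)) alpha delta).
Proof.
move=> ms2 s20 n.
under eq_set do rewrite final_size_leq//.
have [N0n|N0n] /= := leqP N0 n; last first.
  (* For [n < N0] the event is the empty set. *)
  have [+ _ _] := smallest_sigma_algebra setT
    (\big[setU/set0]_(i < n) preimage_set_system setT (Y i) measurable).
  by congr (<<s _ >>); apply/seteqP; split.
pose B := [set t | s2 t * Phi_inv (1 - alpha / 2) ^+ 2 / delta ^+ 2 < n%:R].
apply: (@g_sigma_preimage_sample _ _ _ _ Y _ _ B N0n).
have -> : B = (fun t => s2 t * Phi_inv (1 - alpha / 2) ^+ 2 / delta ^+ 2)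
    @^-1` `]-oo, n%:R[.
  by apply/seteqP; split => t; rewrite /B/= in_itv.
rewrite -[X in measurable X]setTI.
suff mf : measurable_fun setT
    (fun t => s2 t * Phi_inv (1 - alpha / 2) ^+ 2 / delta ^+ 2) by exact: mf.
by do 2 apply: measurable_funM => //.
Qed.

(** * Passage between the scales of precision and of sample size *)

Section precision_scale.
Context {R : realType}.
Implicit Types u d : R.

(** In the factorization of [u - 1] as a difference of squares, the second factor is at least 1.
    This carries consistency over to square roots of sample sizes. *)
Lemma sqrt_dist1 u : 0 <= u -> `|Num.sqrt u - 1| <= `|u - 1|.
Proof.
move=> u0; have -> : u - 1 = (Num.sqrt u - 1) * (Num.sqrt u + 1).
  by rewrite -subr_sqr expr1n sqr_sqrtr.
rewrite normrM ler_peMr// ger0_norm ?addr_ge0 ?sqrtr_ge0//.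
by rewrite lerDr sqrtr_ge0.
Qed.

(** With its converse below, this realizes the substitution [a = 1/d^2]: here consistency is carried
    to [a --> +oo], there the central limit theorem is brought back to [d --> 0]. *)
Lemma cvg_inv_sqrt_pinfty : (Num.sqrt u)^-1 @[u --> +oo] --> (0 : R)^'+.
Proof.
move=> A [e /= e0 eA].
suff : \forall u \near +oo, A (Num.sqrt u)^-1 by [].
near=> u.
have u0 : 0 < u by near: u; exact: nbhs_pinfty_gt.
apply: eA => /=; last by rewrite invr_gt0 sqrtr_gt0.
rewrite sub0r normrN ger0_norm ?invr_ge0 ?sqrtr_ge0//.
rewrite invf_plt ?posrE ?sqrtr_gt0// -[ltLHS]ger0_norm ?invr_ge0 ?(ltW e0)//.
by rewrite -sqrtr_sqr ltr_sqrt//; near: u; apply: nbhs_pinfty_gt; exact: num_real.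
Unshelve. all: by end_near. Qed.

Lemma cvg_inv_sqr_at_right : (d ^+ 2)^-1 @[d --> (0 : R)^'+] --> +oo.
Proof.
apply/cvgryPge => A; have A1 : 0 < `|A| + 1 by rewrite ltr_wpDl.
near=> d; have d0 : 0 < d by [].
have d1 : d < 1 by near: d; exact: nbhs_right_lt.
have dA : d < (`|A| + 1)^-1 by near: d; apply: nbhs_right_lt; rewrite invr_gt0.
rewrite (le_trans (ler_norm A))// (@le_trans _ _ (`|A| + 1)) ?lerDl//.
rewrite -[leLHS]invrK lef_pV2 ?posrE ?exprn_gt0 ?invr_gt0//.
by rewrite expr2 (le_trans _ (ltW dA))// ger_pMr// ltW.
Unshelve. all: by end_near. Qed.

End precision_scale.

(** * Expectations of nonnegative variables *)

Section expectation.
Context d (T : measurableType d) (R : realType) (P : probability T R).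

(** Nonnegativity makes the identity valid in the extended reals, even when the expectation is
    infinite. *)
Lemma ge0_expectationMr (X : T -> R) (c : R) :
  measurable_fun setT X -> (forall w, 0 <= X w) ->
  0 <= c -> ('E_P[fun w => (X w * c)%R] = 'E_P[X] * c%:E)%E.
Proof.
move=> mX X0 c0; rewrite unlock -ge0_integralZr//.
- exact/measurable_EFinP.
- by move=> w _; rewrite lee_fin.
Qed.

Lemma ge0_expectation_div (X : T -> R) (c : R) :
  measurable_fun setT X -> (forall w, 0 <= X w) ->
  0 < c -> ('E_P[X] / c%:E = 'E_P[fun w => (X w / c)%R])%E.
Proof.
by move=> mX X0 c0; rewrite inver gt_eqF// ge0_expectationMr// invr_ge0 ltW.
Qed.

Lemma ge0_expectationDc (X : T -> R) (c : R) :
  measurable_fun setT X -> (forall w, 0 <= X w) ->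
  0 <= c -> ('E_P[fun w => (X w + c)%R] = 'E_P[X] + c%:E)%E.
Proof.
move=> mX X0 c0; rewrite unlock; under eq_integral do rewrite EFinD.
rewrite ge0_integralD//.
- by rewrite integral_cst//= probability_setT mule1.
- by move=> w _; rewrite lee_fin.
- exact/measurable_EFinP.
Qed.

End expectation.

(* The variance estimator is the square of sigmahat n, hence nonnegative. *)
Theorem theorem2p1 (disp : measure_display) (T : measurableType disp)
    (R : realType) (P : probability T R) (Y : nat -> {RV P >-> R})
    (mu sigma sigma_mu sigma3 alpha : R) (N0bar : nat)
    (muhat sigmahat : forall n : nat, {mfun n.-tuple R >-> R}) :
  mutually_independent Y ->
  identically_distributed Y ->
  ('E_P[Y 0%N] = mu%:E)%E ->
  ('V_P[Y 0%N] = (sigma ^+ 2)%:E)%E ->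
  0 < sigma ->
  0 < sigma_mu ->
  0 < sigma3 ->
  0 < alpha < 1 ->
  cvg_in_distribution P \oo
    (fun (n : nat) w => Num.sqrt n%:R * (muhat n (sample Y n w) - mu))
    (normal_prob 0 sigma_mu) ->
  let N0 (d : R) : nat := first_stage_size N0bar alpha sigma3 d in
  let sigmahat2_N0 (d : R) (w : T) : R :=
    sigmahat (N0 d) (sample Y (N0 d) w) ^+ 2 in
  let Nopt (d : R) (w : T) : nat :=
    final_size (N0 d) (sigmahat2_N0 d w) alpha d in
  let Nstar (d : R) : R := optimal_size sigma_mu alpha d in
  cvg_in_probability P 0^'+
    (fun (d : R) w => sigmahat2_N0 d w / sigma_mu ^+ 2) 1 ->
  ('E_P[sigmahat2_N0 d] / (sigma_mu ^+ 2)%:E @[d --> 0^'+] --> 1)%E ->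
  [/\ cvg_in_probability P 0^'+ (fun (d : R) w => (Nopt d w)%:R / Nstar d) 1,
      ('E_P[fun w => (Nopt d w)%:R] / (Nstar d)%:E @[d --> 0^'+] --> 1)%E
    & random_clt Y muhat mu sigma_mu ->
      P [set w | let m := muhat (Nopt d w) (sample Y (Nopt d w) w) in
                 mu \in `[m - d, m + d]] @[d --> 0^'+] --> (1 - alpha)%:E].
Proof.
move=> _ _ _ _ _ sm0 s30 /andP[a0 a1] _ N0 s2 Nopt Nstar cs2 Es2.
pose z := Phi_inv (1 - alpha / 2).
have z0 : 0 < z by apply: Phi_inv_gt0; apply/andP; split; lra.
have Phiz : Phi z = 1 - alpha / 2 by apply: Phi_invK; apply/andP; split; lra.
pose r d := ((N0 d)%:R + 1) / Nstar d.
have r0 : r d @[d --> 0^'+] --> 0 by exact: first_stage_size_negligible.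
have s2_ge0 d w : 0 <= s2 d w by exact: sqr_ge0.
have msigma d : measurable_fun setT
    (fun t : (N0 d).-tuple R => sigmahat (N0 d) t ^+ 2).
  exact: measurable_funX.
have ms2 d : measurable_fun setT (s2 d).
  by apply: (measurableT_comp (msigma d)); exact: measurable_sample.
have stop d : stopping_time Y (Nopt d).
  exact: (@final_size_stopping_time _ _ _ _ Y _ _ alpha d (msigma d)
    (fun=> sqr_ge0 _)).
have mNopt (f : nat -> R) d : measurable_fun setT (fun w => f (Nopt d w)).
  exact: (@measurable_stopped _ _ _ _ Y _ _ _ (fun n => cst (f n))).
have ratio d w : 0 < d ->
    s2 d w / sigma_mu ^+ 2 <= (Nopt d w)%:R / Nstar d
    <= s2 d w / sigma_mu ^+ 2 + r d.
  by move=> d0; exact: final_size_ratio.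
have Nstar_gt0 d : 0 < d -> 0 < Nstar d.
  by move=> d0; rewrite /Nstar /optimal_size !(divr_gt0, mulr_gt0, exprn_gt0).
have consistent :
    cvg_in_probability P 0^'+ (fun d w => (Nopt d w)%:R / Nstar d) 1.
  (* The sandwich [ratio] gives domination with factor 1 and the deterministic error [r]. *)
  apply: (cvg_in_probability_dominated ltr01 r0 _ _ _ cs2).
  - by apply: nearW => d; exact: measurable_funM.
  - by apply: nearW => d; exact: (mNopt (fun n => n%:R / Nstar d) d).
  near=> d; have d0 : 0 < d by [].
  move=> w; have /andP[lo hi] := ratio d w d0.
  rewrite mul1r; set b := s2 d w / _ in lo hi *.
  have : `|b - 1| <= `|b - 1| by []; rewrite ler_norml => /andP[b1 b2].
  by rewrite ler_norml; apply/andP; split; lra.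
split=> //.
(* Taking expectations in [ratio] squeezes the normalized mean size between the normalized mean of
   [s2] and the same quantity plus [r d]. *)
- have Esup : ('E_P[s2 d] / (sigma_mu ^+ 2)%:E + (r d)%:E @[d --> 0^'+] --> 1)%E.
    rewrite -[1%E]adde0; apply: cvgeD => //.
    by apply: cvg_EFin => //; exact: nearW.
  apply: (squeeze_cvge _ Es2 Esup); near=> d; have d0 : 0 < d by [].
  have rd0 : 0 <= r d by rewrite divr_ge0 ?addr_ge0// ltW ?Nstar_gt0.
  have mN := mNopt (fun n => n%:R / Nstar d) d.
  have ms : measurable_fun setT (fun w => s2 d w / sigma_mu ^+ 2).
    exact: measurable_funM.
  have s_ge0 w : 0 <= s2 d w / sigma_mu ^+ 2 by rewrite divr_ge0 ?sqr_ge0.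
  have N_ge0 w : 0 <= (Nopt d w)%:R / Nstar d.
    by rewrite divr_ge0 ?(ltW (Nstar_gt0 _ _)).
  rewrite !ge0_expectation_div ?exprn_gt0 ?Nstar_gt0//.
  rewrite -ge0_expectationDc//; apply/andP; split; apply: expectation_le => //.
  + by apply: aeW => w; have /andP[] := ratio d w d0.
  + exact: measurable_funD.
  + by move=> w; exact: addr_ge0.
  + by apply: aeW => w; have /andP[] := ratio d w d0.
move=> rclt.
(* At precision [d = 1 / sqrt a] the optimal size is exactly [k * a], hence [k] is the limit of
   [N a / a]. *)
pose k := sigma_mu ^+ 2 * z ^+ 2.
have k0 : 0 < k by rewrite mulr_gt0 ?exprn_gt0.
pose N a := Nopt (Num.sqrt a)^-1.
have cN : cvg_in_probability P +oo (fun a w => (N a w)%:R / a) k.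
  pose X a w : R := (N a w)%:R / Nstar (Num.sqrt a)^-1.
  have cX : cvg_in_probability P +oo X 1.
    by move=> e e0; exact: (cvg_comp _ _ cvg_inv_sqrt_pinfty (consistent e e0)).
  apply: (cvg_in_probability_dominated k0 (@cvg_cst _ 0 _ _ _) _ _ _ cX).
  - by apply: nearW => a; exact: (mNopt (fun n => n%:R / Nstar _) _).
  - by apply: nearW => a; exact: (mNopt (fun n => n%:R / a) _).
  near=> a; have a_gt0 : 0 < a by near: a; exact: nbhs_pinfty_gt.
  move=> w.
  (* The domination is an equality: [N a w / a - k] is [k] times [X a w - 1]. *)
  rewrite addr0 -[k in leRHS]gtr0_norm// -normrM mulrBr mulr1.
  rewrite /X /Nstar /optimal_size -/z -/k exprVn sqr_sqrtr ?(ltW a_gt0)//.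
  rewrite le_eqVlt; apply/orP; left; apply/eqP; congr (`|_ - _|).
  by field; rewrite !gt_eqF.
pose Z d w := Num.sqrt (Nopt d w)%:R *
  (muhat (Nopt d w) (sample Y (Nopt d w) w) - mu) / sigma_mu.
have cZ : cvg_in_distribution P 0^'+ Z (normal_prob 0 1).
  (* The limit in [a] is composed with [a = 1/d^2]; for [d > 0] this gives back the sample size at
     precision [d]. *)
  move=> x cx; have := rclt N k (fun a _ => stop _) k0 cN x cx.
  move=> /(cvg_comp _ _ cvg_inv_sqr_at_right); apply: cvg_trans.
  apply: near_eq_cvg; near=> d => /=; congr (P _); apply/funext => w /=.
  by rewrite /N sqrtrV ?sqr_ge0// sqrtr_sqr invrK gtr0_norm.
(* The half-width [d] in the units of [Z]; below, it equals [z] times the square root of the ratio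
   of final to optimal size. *)
pose B d w := Num.sqrt (Nopt d w)%:R * d / sigma_mu.
have cB : cvg_in_probability P 0^'+ B z.
  apply: (cvg_in_probability_dominated z0 (@cvg_cst _ 0 _ _ _) _ _ _ consistent).
  - by apply: nearW => d; exact: (mNopt (fun n => n%:R / Nstar d) d).
  - by apply: nearW => d;
    exact: (mNopt (fun n => Num.sqrt n%:R * d / sigma_mu) d).
  near=> d; have d0 : 0 < d by []; move=> w.
  set u := _ / Nstar d.
  have u0 : 0 <= u by rewrite divr_ge0 ?(ltW (Nstar_gt0 _ _)).
  have -> : B d w = z * Num.sqrt u.
    have Nu : (Nopt d w)%:R = u * (z * sigma_mu / d) ^+ 2.
      rewrite /u /Nstar /optimal_size -/z.
      by field; rewrite !gt_eqF.
    rewrite /B Nu sqrtrM// sqrtr_sqr gtr0_norm ?divr_gt0 ?mulr_gt0//.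
    by field; rewrite !gt_eqF.
  rewrite addr0 -[X in z * _ - X]mulr1 -mulrBr normrM gtr0_norm//.
  by rewrite ler_pM2l// sqrt_dist1.
have mZ d : measurable_fun setT (Z d).
  apply: (@measurable_stopped _ _ _ _ Y _ _ _
    (fun n w => Num.sqrt n%:R * (muhat n (sample Y n w) - mu) / sigma_mu)) => //.
  move=> n; apply: measurable_funM => //; apply: measurable_funM => //.
  apply: measurable_funB => //.
  by apply: measurableT_comp => //; exact: measurable_sample.
have -> : 1 - alpha = Phi z - Phi (- z) by rewrite PhiN Phiz; lra.
have mB d : measurable_fun setT (B d).
  exact: (mNopt (fun n => Num.sqrt n%:R * d / sigma_mu) d).
have : P [set w | `|Z d w| <= B d w] @[d --> 0^'+] --> (Phi z - Phi (- z))%:E.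
  by apply: cvg_random_interval => //; [exact: ltW|exact: nearW|exact: nearW].
apply: cvg_trans; apply: near_eq_cvg; near=> d; congr (P _).
apply/funext => w; apply/propext; rewrite /= in_itv/= -ler_distlC.
(* The successor in [final_size] keeps the sample size positive, so rescaling the coverage
   inequality by this factor is an equivalence. *)
have sN : 0 < Num.sqrt (Nopt d w)%:R / sigma_mu.
  by rewrite divr_gt0// sqrtr_gt0 ltr0n /Nopt /final_size leq_max orbT.
rewrite /Z /B ![Num.sqrt _ * _ / _]mulrAC normrM (gtr0_norm sN).
by rewrite ler_pM2l// distrC.
Unshelve. all: by end_near. Qed.
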